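(* Let $d\ge1$, $n\in\mathbb{N}$, $M\in\mathbb{C}^{d\times d}$, and denote by $m_1,\ldots,m_d\in\mathbb{C}^d$ the row vectors of $M$. Then, for all $x\in X_n$, the components of the vector $M^{n\otimes}x\in X_n$ can be labelled by multi-indices $k=(k_1,\ldots,k_d)\in\mathbb{N}^d$ with $|k|=n$ and satisfy \[ \left(M^{n\otimes}x\right)_k=\sum_{|\alpha_1|=k_1}\cdots\sum_{|\alpha_d|=k_d}\binom{k_1}{\alpha_1}\cdots\binom{k_d}{\alpha_d}\,m_1^{\alpha_1}\cdots m_d^{\alpha_d}\;x_{\alpha_1+\cdots+\alpha_d}, \] where the summation ranges over $\alpha_1,\ldots,\alpha_d\in\mathbb{N}^d$ with $|\alpha_1|=k_1,\ldots,|\alpha_d|=k_d$.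
   Context: $\mathbb{N}=\{0,1,2,\ldots\}$. For $k=(k_1,\ldots,k_d)\in\mathbb{N}^d$: $|k|=k_1+\cdots+k_d$, $\binom{|k|}{k}=\frac{|k|!}{k_1!\cdots k_d!}$, and for $v\in\mathbb{C}^d$, $v^k=v_1^{k_1}\cdots v_d^{k_d}$ (with $0^0=1$). Let $\nu_n=(\nu_n(1),\ldots,\nu_n(d^n))$ be the redundant list of multi-indices of modulus $n$ defined recursively by $\nu_0=((0,\ldots,0))$ and $\nu_{n+1}((m-1)d^n+j)=\nu_n(j)+e_m^t$ for $m=1,\ldots,d$, $j=1,\ldots,d^n$, where $e_m$ is the $m$th standard basis vector of $\mathbb{C}^d$. The $n$th symmetric subspace is \[X_n=\{x\in\mathbb{C}^{d^n}:\ x_j=x_{j'}\text{ for all }j,j'\in\{1,\ldots,d^n\}\text{ with }\nu_n(j)=\nu_n(j')\}.\] For $x\in X_n$ and a multi-index $k$ with $|k|=n$, $x_k$ denotes the common value of $x_j$ over all $j$ with $\nu_n(j)=k$. $M^{n\otimes}=M\otimes\cdots\otimes M$ ($n$ factors, usual Kronecker product, so $M^{(n+1)\otimes}$ is the block matrix with blocks $M_{ij}M^{n\otimes}$; $M^{0\otimes}=1$). *)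

(* Defs.v *)
From mathcomp Require Import all_boot all_order all_algebra.
From mathcomp Require Import reals.
From mathcomp Require Import complex mxtens mpoly.

Set Implicit Arguments.
Unset Strict Implicit.
Unset Printing Implicit Defensive.

Import GRing.Theory.
Local Open Scope ring_scope.

(* Multi-indices in N^d are the monomials 'X_{1..d} of multinomials:
   mdeg k is |k|, U_(m)%MM is the m-th standard basis vector, and
   mmap1 v k is v^k = \prod_i v i ^+ k i (with 0 ^+ 0 = 1). *)

Definition multinomial_coef (d : nat) (k : 'X_{1..d}) : nat :=
  ((mdeg k)`! %/ \prod_(i < d) (k i)`!)%N.

Lemma multinomial_coefK (d : nat) (k : 'X_{1..d}) :
  (multinomial_coef k * \prod_(i < d) (k i)`! = (mdeg k)`!)%N.
Proof.
apply: divnK; rewrite mdegE.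
elim/big_rec2: _ => [|i t s _ IH]; first exact: dvd1n.
rewrite -(bin_fact (leq_addr s (k i))) addKn dvdn_mull //.
exact: dvdn_mul.
Qed.

(* The m-th block of length d ^ n of [nu d n.+1] is the list [nu d n] shifted
   by the m-th basis vector; see [nth_nuS]. Positions are counted from 0. *)
Fixpoint nu (d n : nat) : seq 'X_{1..d} :=
  if n is n'.+1 then
    [seq (k + U_(m))%MM | m <- enum 'I_d, k <- nu d n']
  else [:: 0%MM].

Lemma size_nu (d n : nat) : size (nu d n) = (d ^ n)%N.
Proof.
by elim: n => //= n IH; rewrite size_allpairs size_enum_ord IH expnS.
Qed.

Lemma nth_nuS (d n : nat) (m : 'I_d) (j : nat) : (j < d ^ n)%N ->
  nth 0%MM (nu d n.+1) (m * d ^ n + j) = (nth 0%MM (nu d n) j + U_(m))%MM.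
Proof.
move=> lt_j; pose g (m : 'I_d) := [seq (k + U_(m))%MM | k <- nu d n].
have E : forall (s : seq 'I_d) (p : nat), (p < size s)%N ->
    nth 0%MM (flatten (map g s)) (p * d ^ n + j)
    = (nth 0%MM (nu d n) j + U_(nth m s p))%MM.
  elim=> //= a s IH [|p] lt_p; rewrite nth_cat size_map size_nu.
    by rewrite mul0n add0n lt_j (nth_map 0%MM) ?size_nu.
  by rewrite mulSn -addnA ltnNge leq_addr /= addKn IH.
by have := E (enum 'I_d) m; rewrite size_enum_ord ltn_ord nth_ord_enum => ->.
Qed.

Definition nu_at (d n : nat) (j : 'I_(d ^ n)) : 'X_{1..d} :=
  nth 0%MM (nu d n) j.

Lemma mem_nu (d n : nat) (k : 'X_{1..d}) : (k \in nu d n) = (mdeg k == n).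
Proof.
elim: n k => [|n IH] k /=; first by rewrite inE mdeg_eq0.
apply/allpairsP/eqP => [[[m l] /= [_ + ->]]|dk].
  by rewrite IH mdegD mdeg1 addn1 => /eqP->.
have [m km] : exists m, (0 < k m)%N.
  apply/existsP; apply: contraPT dk; rewrite negb_exists => /forallP k0.
  by rewrite mdegE big1 // => i _; apply/eqP; rewrite eqn0Ngt.
have le1 : (U_(m) <= k)%MM by rewrite lep1mP -lt0n.
exists (m, (k - U_(m))%MM); split; rewrite ?mem_enum //=; last by rewrite submK.
by rewrite IH -(eqn_add2r 1) -{1}(mdeg1 m) -mdegD submK // dk addn1.
Qed.

Lemma nu_at_surj (d n : nat) (k : 'X_{1..d}) :
  mdeg k = n -> exists j : 'I_(d ^ n), nu_at j = k.
Proof.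
move=> /eqP; rewrite -mem_nu => kin.
have lt_j : (index k (nu d n) < d ^ n)%N by rewrite -size_nu index_mem.
by exists (Ordinal lt_j); rewrite /nu_at nth_index.
Qed.

Definition in_symspace (C : Type) (d n : nat) (x : 'cV[C]_(d ^ n)) : Prop :=
  forall j j' : 'I_(d ^ n), nu_at j = nu_at j' -> x j ord0 = x j' ord0.

(* The common value x_k of the entries of x at the positions of k in [nu d n];
   only meaningful if [in_symspace x] and |k| = n (see [symcoefE], [nu_at_surj]). *)
Definition symcoef (C : nmodType) (d n : nat) (x : 'cV[C]_(d ^ n))
    (k : 'X_{1..d}) : C :=
  if [pick j : 'I_(d ^ n) | nu_at j == k] is Some j then x j ord0 else 0.

Lemma symcoefE (C : nmodType) (d n : nat) (x : 'cV[C]_(d ^ n))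
    (j : 'I_(d ^ n)) :
  in_symspace x -> symcoef x (nu_at j) = x j ord0.
Proof.
move=> xS; rewrite /symcoef; case: pickP => [i /eqP/xS //|/(_ j)].
by rewrite eqxx.
Qed.

Lemma ntensmx_block (C : comNzRingType) (d n : nat) (M : 'M[C]_d)
    (i j : 'I_d) (p q : 'I_(d ^ n)) (r s : 'I_(d ^ n.+1)) :
  r = (i * d ^ n + p)%N :> nat -> s = (j * d ^ n + q)%N :> nat ->
  (M ^t n.+1) r s = M i j * (M ^t n) p q.
Proof.
case: n p q r s => [|n] p q r s er es.
  have [p0 q0] : p = ord0 /\ q = ord0 by split; apply: ord1.
  rewrite p0 q0 /ntensmx /= mxE mulr1 in er es *.
  by congr (M _ _); apply: val_inj; rewrite /= ?er ?es expn0 muln1 addn0.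
have -> : r = mxtens_index (i, p) by apply: val_inj.
have -> : s = mxtens_index (j, q) by apply: val_inj.
by rewrite ntensmxSS tensmxE.
Qed.

(* Main.v *)
Require Import Defs.
From mathcomp Require Import all_boot all_order all_algebra.
From mathcomp Require Import reals.
From mathcomp Require Import complex mxtens mpoly.
Local Open Scope ring_scope.
Import GRing.Theory.

Set Implicit Arguments.
Unset Strict Implicit.

(** Attach to position s of a vector of length d ^ n the monomial X^(nu_at s).
    For i < d let l_i = M_(i,1) X_1 + ... + M_(i,d) X_d be the linear form with
    the coefficients of row i of M. The r-th row of the n-fold Kronecker power
    of M, read as a combination of these monomials, is the product of the
    l_i ^ (nu_at r)_i: by the block structure, prefixing an index i to the
    position r multiplies its row polynomial by l_i, and it adds U_(i) to
    nu_at r ([ntensmx_row_monomials]).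

    A symmetric x depends on a position only through the monomial there, so the
    entry of M^t n *m x at r arises from the row polynomial by substituting
    x_m for X^m. The value of such a substitution does not depend on how the
    polynomial is written as a combination of monomials ([eq_sum_monomials]).
    Two facts follow. The row polynomial, hence the entry at r, depends on r
    only through nu_at r, so M^t n *m x is symmetric. And the entry may be
    computed from any other expansion of the product of the l_i ^ k_i; the one
    given by the multinomial theorem ([linformX]) and distributivity is the
    asserted formula. *)

(** Dividing |k|! by the product of the (k i)! with one factor k j removed
    gives this in two ways; it is the absorption identity for binomials. *)
Lemma multinomial_coef_subU (d : nat) (k : 'X_{1..d}) (j : 'I_d) :
  (0 < k j)%N ->
  (mdeg k * multinomial_coef (k - U_(j))%MM = k j * multinomial_coef k)%N.
Proof.
move=> kj; have le1 : (U_(j) <= k)%MM by rewrite lep1mP -lt0n.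
have dk : mdeg k = (mdeg (k - U_(j))%MM).+1.
  by rewrite -{1}(submK le1) mdegD mdeg1 addn1.
have prod_fact : (k j * \prod_(i < d) ((k - U_(j))%MM i)`!
                  = \prod_(i < d) (k i)`!)%N.
  rewrite (bigD1 j) //= [RHS](bigD1 j) //= mulnA; congr (_ * _)%N.
    by rewrite mnmBE mnm1E eqxx subn1 -{1 3}(prednK kj) factS.
  apply: eq_bigr => i ne_ij.
  by rewrite mnmBE mnm1E eq_sym (negbTE ne_ij) subn0.
have P0 : (0 < \prod_(i < d) ((k - U_(j))%MM i)`!)%N.
  by rewrite prodn_gt0 // => i; rewrite fact_gt0.
apply/eqP; rewrite -(eqn_pmul2r P0) -mulnA multinomial_coefK.
rewrite (mulnC (k j)) -mulnA prod_fact multinomial_coefK.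
by rewrite dk factS.
Qed.

(** Summing the absorption identity over j multiplies both sides by |k|, as the
    k j add up to |k|. *)
Lemma multinomial_coef_pascal (d : nat) (k : 'X_{1..d}) :
  (0 < mdeg k)%N ->
  multinomial_coef k
  = (\sum_(j < d | 0 < k j) multinomial_coef (k - U_(j))%MM)%N.
Proof.
move=> dk; apply/eqP; rewrite -(eqn_pmul2l dk) big_distrr /=.
rewrite (eq_bigr (fun j => k j * multinomial_coef k)%N); last first.
  by move=> j; exact: multinomial_coef_subU.
rewrite -big_distrl /= mdegE; apply/eqP; congr (_ * _)%N.
by rewrite [RHS]big_mkcond /=; apply: eq_bigr => i _; case: (k i).
Qed.

Lemma mcoeffMXU (R : nzRingType) (d : nat) (p : {mpoly R[d]}) (j : 'I_d)
    (k : 'X_{1..d}) :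
  (p * 'X_j)@_k = if (0 < k j)%N then p@_(k - U_(j)) else 0.
Proof.
case: ifPn => [kj|].
  rewrite -{1}(@submK _ U_(j) k); last by rewrite lep1mP -lt0n.
  by rewrite addmC mcoeffMX.
rewrite -eqn0Ngt => /eqP kj.
rewrite [p]mpolyE mulr_suml raddf_sum big1 //= => m _.
rewrite -scalerAl -mpolyXD mcoeffZ mcoeffX.
case: eqP kj => [<-|]; last by rewrite mulr0.
by rewrite mnmDE mnm1E eqxx addn1.
Qed.

Definition linform (C : comNzRingType) (d : nat) (v : 'I_d -> C) :
  {mpoly C[d]} := \sum_(j < d) v j *: 'X_j.

(** The multinomial theorem, one coefficient at a time: multiplying by one more
    factor shifts the coefficients by the U_(j), and the coefficients add up by
    Pascal's rule. *)
Lemma mcoeff_linformX (C : comNzRingType) (d : nat) (v : 'I_d -> C) (n : nat)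
    (k : 'X_{1..d}) :
  (linform v ^+ n)@_k
  = if mdeg k == n then (multinomial_coef k)%:R * mmap1 v k else 0.
Proof.
elim: n k => [|n IH] k.
  rewrite expr0 mcoeff1 mdeg_eq0; case: eqP => // ->.
  rewrite mmap11 mulr1 /multinomial_coef mdeg0 big1 ?divn1 // => i _.
  by rewrite mnm0E.
rewrite exprSr /linform mulr_sumr raddf_sum /=.
rewrite (eq_bigr (fun j => if (0 < k j)%N && (mdeg k == n.+1)
    then (multinomial_coef (k - U_(j))%MM)%:R * mmap1 v k else 0)); last first.
  move=> j _; rewrite -scalerAr mcoeffZ mcoeffMXU.
  case: ifP => [kj|_]; last by rewrite mulr0.
  have le1 : (U_(j) <= k)%MM by rewrite lep1mP -lt0n.
  have -> : mdeg k = (mdeg (k - U_(j))%MM).+1.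
    by rewrite -{1}(submK le1) mdegD mdeg1 addn1.
  have -> : mmap1 v k = v j * mmap1 v (k - U_(j))%MM.
    rewrite -{1}(submK le1) commr_mmap1_M ?mmap1U 1?mulrC //.
    by move=> i y; exact: mulrC.
  by rewrite IH eqSS; case: ifP => _; rewrite ?mulr0 // mulrCA.
case: eqP => [dk|_]; last by rewrite big1 // => j _; rewrite andbF.
rewrite multinomial_coef_pascal ?dk // natr_sum mulr_suml [RHS]big_mkcond.
by apply: eq_bigr => j _; rewrite andbT.
Qed.

(** Since linform v ^+ n is homogeneous of degree n, any b > n bounds the
    degrees that occur; b is free so that powers with different exponents can
    be expanded over one common finite type. *)
Lemma linformX (C : comNzRingType) (d : nat) (v : 'I_d -> C) (n b : nat) :
  (n < b)%N ->
  linform v ^+ n = \sum_(a : 'X_{1..d < b} | mdeg a == n)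
    ((multinomial_coef a)%:R * mmap1 v a) *: 'X_[a].
Proof.
move=> lt_nb; rewrite {1}(@mpolywE _ _ b (linform v ^+ n)); last first.
  rewrite msizeE; apply/bigmax_leqP_seq => k + _.
  rewrite mcoeff_msupp mcoeff_linformX.
  by case: ifP => [/eqP-> //|_]; rewrite eqxx.
rewrite [RHS]big_mkcond; apply: eq_bigr => a _; rewrite mcoeff_linformX.
by case: ifP; rewrite ?scale0r.
Qed.

Lemma sum_mul_mcoeff (C : nzRingType) (d : nat) (I : finType) (P : pred I)
    (c : I -> C) (u : I -> 'X_{1..d}) (f : 'X_{1..d} -> C)
    (s : seq 'X_{1..d}) :
  uniq s -> (forall i, u i \in s) ->
  \sum_(i | P i) c i * f (u i)
  = \sum_(m <- s) (\sum_(i | P i) c i *: 'X_[u i])@_m * f m.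
Proof.
move=> us su; under [RHS]eq_bigr do rewrite raddf_sum mulr_suml.
rewrite exchange_big /=; apply: eq_bigr => i _.
rewrite (bigD1_seq (u i)) //= mcoeffZ mcoeffX eqxx mulr1 big1 ?addr0 //.
by move=> m ne; rewrite mcoeffZ mcoeffX eq_sym (negbTE ne) mulr0 mul0r.
Qed.

(** The monomials are a basis, so X^m |-> f m extends to a well-defined linear
    functional on polynomials. *)
Lemma eq_sum_monomials (C : nzRingType) (d : nat) (I J : finType)
    (P : pred I) (Q : pred J) (c : I -> C) (c' : J -> C)
    (u : I -> 'X_{1..d}) (u' : J -> 'X_{1..d}) (f : 'X_{1..d} -> C) :
  \sum_(i | P i) c i *: 'X_[C, u i] = \sum_(j | Q j) c' j *: 'X_[u' j] ->
  \sum_(i | P i) c i * f (u i) = \sum_(j | Q j) c' j * f (u' j).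
Proof.
move=> E; pose s := undup (codom u ++ codom u').
have su i : u i \in s by rewrite mem_undup mem_cat codom_f.
have su' j : u' j \in s by rewrite mem_undup mem_cat codom_f orbT.
by rewrite !(@sum_mul_mcoeff _ _ _ _ _ _ _ s) ?undup_uniq // E.
Qed.

(** The type of the positions of length d ^ n.+1 is not convertible to that of
    the pairs coded by [mxtens_index] when n = 0, hence the cast. *)
Definition block_index {d n : nat} (i : 'I_d) (p : 'I_(d ^ n)) :
    'I_(d ^ n.+1) :=
  cast_ord (esym (expnS d n)) (mxtens_index (i, p)).

Lemma block_index_bij (d n : nat) :
  bijective (fun ip : 'I_d * 'I_(d ^ n) => block_index ip.1 ip.2).
Proof.
exists (fun r => mxtens_unindex (cast_ord (expnS d n) r)) => [[i p]|r] /=.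
  by rewrite /block_index cast_ordKV mxtens_indexK.
by apply: val_inj; rewrite /= -divn_eq.
Qed.

Lemma nu_at_block (d n : nat) (i : 'I_d) (p : 'I_(d ^ n)) :
  nu_at (block_index i p) = (nu_at p + U_(i))%MM.
Proof. by rewrite /nu_at nth_nuS. Qed.

(** Column block j of row block i of M^t n.+1 is M i j times M^t n, and its
    monomials carry an extra 'X_j; summing over j factors out linform (M i). *)
Lemma ntensmx_row_monomials (C : comNzRingType) (d n : nat) (M : 'M[C]_d)
    (r : 'I_(d ^ n)) :
  \sum_(s < d ^ n) (M ^t n) r s *: 'X_[nu_at s]
  = \prod_(i < d) linform (M i) ^+ nu_at r i.
Proof.
elim: n r => [|n IH] r.
  rewrite big_ord1 !(ord1 r) ntensmx0 mxE scale1r /nu_at /= mpolyX0.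
  by rewrite big1 // => i _; rewrite mnm0E expr0.
have [g gK Kg] := block_index_bij d n.
rewrite -(Kg r); case: (g r) => i p /=.
rewrite (reindex _ (onW_bij _ (block_index_bij d n))) /=.
rewrite -(pair_big xpredT xpredT
  (fun j q => (M ^t n.+1) (block_index i p) (block_index j q)
              *: 'X_[nu_at (block_index j q)])) /=.
rewrite (eq_bigr (fun j => (M i j *: 'X_j) *
    \prod_(i0 < d) linform (M i0) ^+ nu_at p i0)); last first.
  move=> j _; rewrite -IH mulr_sumr; apply: eq_bigr => q _.
  rewrite (@ntensmx_block _ _ _ _ i j p q) // nu_at_block mpolyXD.
  by rewrite -scalerAl -scalerAr scalerA mulrC [X in _ *: X]mulrC.
rewrite -mulr_suml -/(linform (M i)) nu_at_block.
rewrite [in RHS](bigD1 i) //= [in LHS](bigD1 i) //= mulrA.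
rewrite mnmDE mnm1E eqxx addn1 exprS; congr (_ * _).
by apply: eq_bigr => l nl; rewrite mnmDE mnm1E eq_sym (negbTE nl) addn0.
Qed.

Theorem proposition2 (R : realType) (d n : nat) (hd : (1 <= d)%N)
    (M : 'M[R[i]]_d) (x : 'cV[R[i]]_(d ^ n)) (hx : @in_symspace R[i] d n x) :
  @in_symspace R[i] d n (M ^t n *m x) /\
  forall k : 'X_{1..d}, mdeg k = n ->
    @symcoef R[i] d n (M ^t n *m x) k =
    (* the bound on the degrees is no restriction, as k i <= mdeg k = n *)
    \sum_(a : {ffun 'I_d -> 'X_{1..d < n.+1}} | [forall i, mdeg (a i) == k i])
      (\prod_(i < d) (multinomial_coef (a i))%:R) *
      (\prod_(i < d) mmap1 (row i M ord0) (a i)) *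
      @symcoef R[i] d n x (\sum_(i < d) (a i : 'X_{1..d}))%MM.
Proof.
have entryE (r : 'I_(d ^ n)) : (M ^t n *m x) r ord0
    = \sum_(s < d ^ n) (M ^t n) r s * symcoef x (nu_at s).
  by rewrite mxE; apply: eq_bigr => s _; rewrite symcoefE.
have symMx : in_symspace (M ^t n *m x).
  (* equal multi-indices at r and r' give equal row polynomials *)
  move=> r r' Err'; rewrite !entryE; apply: eq_sum_monomials.
  by rewrite !ntensmx_row_monomials Err'.
split=> // k dk; have [r rk] := nu_at_surj dk.
rewrite -rk symcoefE // entryE; apply: eq_sum_monomials.
rewrite ntensmx_row_monomials rk.
rewrite (eq_bigr (fun i => \sum_(a : 'X_{1..d < n.+1} | mdeg a == k i)
    ((multinomial_coef a)%:R * mmap1 (row i M ord0) a) *: 'X_[a])); last first.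
  move=> i _; rewrite (@linformX _ _ _ _ n.+1); last first.
    by rewrite ltnS -dk mdegE (bigD1 i) //= leq_addr.
  apply: eq_bigr => a _; congr (_ * _ *: _).
  by apply: eq_bigr => j _; rewrite mxE.
rewrite bigA_distr_big_dep /=; apply: eq_bigr => a _.
by rewrite scaler_prod -mprodXE big_split.
Qed.
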